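(* Let $n \ge 4$ be an integer with $n \ne 6$, and let $\rho$ be an integer with $1 \le \rho \le n$. Then there exists a $(3n+\rho,4)$-packing with exactly $n\rho + D(\rho,4)$ blocks in which the largest partial parallel class has size $\rho$.
   Context: For integers $v \ge k \ge 2$, a $(v,k)$-packing is a pair $(X,\mathcal{B})$ where $X$ is a set of $v$ points and $\mathcal{B}$ is a set of $k$-subsets of $X$ (blocks) such that every pair of distinct points lies in at most one block. For integers $m \ge 0$, $D(m,k)$ denotes the maximum number of $k$-subsets of an $m$-set such that every pair of points lies in at most one of them (so $D(m,k)=0$ if $m<k$). A partial parallel class (PPC) is a set of pairwise disjoint blocks; its size is the number of blocks. ''The largest PPC has size $\rho$'' means the packing has a PPC of size $\rho$ but none of size $\rho+1$. *)

(* Defs.v *)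
From mathcomp Require Import all_boot.
Set Implicit Arguments. Unset Strict Implicit. Unset Printing Implicit Defensive.

Definition is_packing (v k : nat) (Bs : {set {set 'I_v}}) : Prop :=
  (forall B, B \in Bs -> #|B| = k) /\
  (forall x y : 'I_v, x != y ->
     #|[set B in Bs | (x \in B) && (y \in B)]| <= 1).

Definition is_packingb (v k : nat) (Bs : {set {set 'I_v}}) : bool :=
  [forall B in Bs, #|B| == k] &&
  [forall x : 'I_v, forall y : 'I_v,
     (x != y) ==> (#|[set B in Bs | (x \in B) && (y \in B)]| <= 1)].

Definition Dpack (m k : nat) : nat :=
  \max_(Bs : {set {set 'I_m}} | is_packingb k Bs) #|Bs|.

Definition is_PPC (v : nat) (Bs P : {set {set 'I_v}}) : Prop :=
  P \subset Bs /\
  (forall B1 B2, B1 \in P -> B2 \in P -> B1 != B2 -> [disjoint B1 & B2]).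

Definition largest_PPC_size (v : nat) (Bs : {set {set 'I_v}}) (rho : nat) : Prop :=
  (exists P, is_PPC Bs P /\ #|P| = rho) /\
  ~ (exists P, is_PPC Bs P /\ #|P| = rho.+1).

(* Main.v *)
Require Import Defs.
From mathcomp Require Import all_boot all_algebra.
From mathcomp Require Import zify.
Set Implicit Arguments. Unset Strict Implicit. Unset Printing Implicit Defensive.
Import GRing.Theory.

(** It suffices to have, on 3n points, n classes of n disjoint triples, any
two triples of distinct classes sharing at most one point, and a transversal:
one triple from each class, pairwise disjoint. Keep rho of the classes, add a
new point to all triples of each of them, and pack the rho new points
optimally. Every block contains a new point, so a partial parallel class has
at most rho blocks, and the transversal gives one of size exactly rho.

If n is coprime to 6, the classes are the translates in Z_n of the triples
{u_0, (2u)_1, (-u)_2}, where the index is a level; the transversal consists of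
the translates of the triple u = 0. The triples of a class use no pair of
points of the same level. These unused pairs allow going from order m coprime
to 6 to order m + s. For each j < s, break the five triples with
u = z, z', t_0, t_1, t_2: the points of level k of the triples z, z', t_k form
a triple on a single level, the two remaining points of the triple t_k form a
triple with a point at infinity, and the translates of the triple z, now free,
form an additional class, completed by a class of a system of order s on the
points at infinity. With s = 0, 1, 4, 5 this covers all but eleven orders,
which are obtained from starters over Z_n. *)

Local Notation level := (option bool).

(** * From rainbow triangle factors to packings *)

(* [B c i] is the [i]-th triple of the class [c], and [r c] the index of the
   triple of [c] that belongs to the transversal. *)
Definition rainbow_factors (T : finType) : Prop :=
  exists (B : T -> T -> level -> level * T) (r : T -> T),
  [/\ forall c i i' a a', B c i a = B c i' a' -> i = i' /\ a = a',
      forall c d i j a b a' b', a != b ->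
        B c i a = B d j a' -> B c i b = B d j b' -> c = d
    & forall c d a b, B c (r c) a = B d (r d) b -> c = d].

Lemma Dpack_attained (m k : nat) :
  exists Ds : {set {set 'I_m}}, is_packing k Ds /\ #|Ds| = Dpack m k.
Proof.
have P0 : is_packingb k (set0 : {set {set 'I_m}}).
  apply/andP; split; first by apply/forallP=> B; rewrite inE.
  apply/forallP=> x; apply/forallP=> y; apply/implyP=> _.
  by apply/card_le1_eqP=> B B'; rewrite !inE.
have [|Ds /andP[/forall_inP D1 /forallP D2] E] :=
  @eq_bigmax_cond _ [pred Bs | is_packingb k Bs] (fun Bs : {set {set 'I_m}} => #|Bs|).
  by apply/card_gt0P; exists set0.
exists Ds; split; last by rewrite /Dpack E.
split=> [B /D1/eqP //|x y xy].
by move/forallP: (D2 x) => /(_ y)/implyP; apply.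
Qed.

Lemma packing_of_factors (T : finType) (rho : nat) :
  rainbow_factors T -> 1 <= rho <= #|T| ->
  exists Bs : {set {set 'I_(3 * #|T| + rho)}},
    is_packing 4 Bs /\ #|Bs| = #|T| * rho + Dpack rho 4 /\
    largest_PPC_size Bs rho.
Proof.
move=> [B [r [Binj Blin Brain]]] /andP[rho_gt0 rho_le].
pose V := (level * T + 'I_rho)%type.
have cardV : #|{: V}| = 3 * #|T| + rho.
  by rewrite card_sum card_prod card_option card_bool card_ord.
pose h (v : V) := cast_ord cardV (enum_rank v).
have hI : injective h by move=> u v /cast_ord_inj/enum_rank_inj.
(* The classes kept are the first [rho] ones in the enumeration of [T]. *)
pose s (p : 'I_rho) : T := enum_val (widen_ord rho_le p).
have sI : injective s by move=> p q /enum_val_inj/(congr1 val) /= /val_inj.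
have [Ds [[Ds4 Ds1] cardDs]] := Dpack_attained rho 4.
pose line p i : {set _} := [set h (inl (B (s p) i a)) | a : level].
pose blk p i := h (inr p) |: line p i.
pose top (A : {set 'I_rho}) : {set _} := [set h (inr p) | p in A].
have in_line p i v : (h v \in line p i) -> exists a, v = inl (B (s p) i a).
  by case/imsetP=> a _ /hI ->; exists a.
have blk_r p' p i : (h (inr p') \in blk p i) = (p' == p).
  rewrite !inE (inj_eq hI) orbC; case: (boolP (_ \in line p i)) => //=.
  by move/in_line=> [].
have blk_l p i v : h (inl v) \in blk p i -> exists a, v = B (s p) i a.
  by rewrite !inE (inj_eq hI) /= => /in_line [a [->]]; exists a.
have blkB p i a : h (inl (B (s p) i a)) \in blk p i.
  by apply/setU1P; right; apply/imsetP; exists a.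
have top_r p A : (h (inr p) \in top A) = (p \in A).
  by apply: (@mem_imset _ _ (fun p => h (inr p))) => u v /hI [].
have top_l v A : h (inl v) \in top A = false.
  by apply/negP=> /imsetP[p _ /hI].
have card_top A : #|top A| = #|A| by rewrite card_imset // => u v /hI [].
have topI : injective top.
  by move=> A A' E; apply/setP=> p; rewrite -!top_r E.
have blkI : injective (fun q : 'I_rho * T => blk q.1 q.2).
  move=> [p i] [p' i'] /= E.
  have /eqP Ep : p == p' by rewrite -(blk_r p p' i') -E blk_r.
  rewrite -Ep in E *.
  by have := blkB p i None; rewrite E => /blk_l [a /Binj[-> _]].
pose Bs := [set blk q.1 q.2 | q : 'I_rho * T] :|: [set top A | A in Ds].
have BsP X : X \in Bs ->
    (exists p i, X = blk p i) \/ (exists2 A, A \in Ds & X = top A).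
  case/setUP=> /imsetP[q qD ->]; first by left; exists q.1, q.2.
  by right; exists q.
have blkBs p i : blk p i \in Bs.
  by apply/setUP; left; apply/imsetP; exists (p, i).
exists Bs; split; last split.
- split=> [X /BsP[[p [i ->]]|[A /Ds4 A4 ->]]|x y xy].
  + rewrite cardsU1 card_imset ?card_option ?card_bool; last first.
      by move=> a a' /hI [/Binj[_]].
    case: (boolP (_ \in line p i)) => //.
    by move/in_line=> [].
  + by rewrite card_top.
  apply/card_le1_eqP=> X Y.
  (* A common new point fixes the class, and a common old point then fixes the triple, since triples
     of a class are disjoint. Two common old points fix the class by [Blin]. *)
  have blk_uniq p i p' i' : x \in blk p i -> y \in blk p i ->
      x \in blk p' i' -> y \in blk p' i' -> blk p i = blk p' i'.
    have same_p a b : a != b -> B (s p) i a \in [set B (s p') i' c | c : level] ->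
       B (s p) i b \in [set B (s p') i' c | c : level] -> blk p i = blk p' i'.
      move=> ab /imsetP[a' _ Ea] /imsetP[b' _ Eb].
      have /sI E := Blin _ _ _ _ _ _ _ _ ab Ea Eb; rewrite -E in Ea Eb *.
      by have [-> _] := Binj _ _ _ _ _ Ea.
    case/setU1P=> [Ex|/imsetP[a _ Ex]]; case/setU1P=> [Ey|/imsetP[b _ Ey]].
    * by rewrite Ex Ey eqxx in xy.
    * rewrite Ex Ey blk_r => /eqP <- /blk_l[b' /Binj[-> _]] //.
    * rewrite Ex Ey blk_r => /blk_l[b' Eb] /eqP Ep.
      by rewrite -Ep in Eb *; have [-> _] := Binj _ _ _ _ _ Eb.
    rewrite Ex Ey => /blk_l[a' Ea] /blk_l[b' Eb].
    apply: (same_p a b); last 2 first.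
    * by apply/imsetP; exists a'.
    * by apply/imsetP; exists b'.
    by apply: contraNneq xy => E; rewrite Ex Ey E.
  have blk_top p i A : x \in blk p i -> y \in blk p i ->
      x \in top A -> y \in top A -> False.
    move=> x1 y1 /imsetP[p1 _ Ex] /imsetP[p2 _ Ey].
    move: x1 y1 xy; rewrite Ex Ey !blk_r => /eqP -> /eqP ->.
    by rewrite eqxx.
  move=> /setIdP[/BsP X1 /andP[xX yX]] /setIdP[/BsP Y1 /andP[xY yY]].
  case: X1 => [[p [i EX]]|[A AD EX]]; case: Y1 => [[p' [i' EY]]|[A' AD' EY]];
    rewrite {}EX {}EY in xX yX xY yY *.
  + exact: blk_uniq.
  + by case: (blk_top p i A').
  + by case: (blk_top p' i' A).
  case/imsetP: xX (xX) => p1 _ Ex; case/imsetP: yX (yX) => p2 _ Ey.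
  rewrite Ex Ey !top_r in xY yY * => p1A p2A.
  have p12 : p1 != p2 by apply: contraNneq xy => E; rewrite Ex Ey E.
  have /card_le1_eqP/(_ A A') -> // := Ds1 _ _ p12.
    by rewrite inE AD p1A p2A.
  by rewrite inE AD' xY yY.
- rewrite cardsU card_imset // card_imset // card_prod card_ord cardDs.
  suff -> : [set blk q.1 q.2 | q : 'I_rho * T] :&: [set top A | A in Ds] = set0.
    by rewrite cards0 subn0 mulnC.
  apply/setP=> X; rewrite !inE; apply/negP=> /andP[/imsetP[q _ ->] /imsetP[A _ E]].
  by have := blkB q.1 q.2 None; rewrite E top_l.
split.
  exists [set blk p (r (s p)) | p : 'I_rho]; split; last first.
    by rewrite card_imset ?card_ord // => p q E; have [] := blkI (_, _) (_, _) E.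
  split=> [|X Y /imsetP[p _ ->] /imsetP[q _ ->] XY].
    by apply/subsetP=> X /imsetP[p _ ->].
  apply/pred0P=> x /=; apply/negP=> /andP[xX xY].
  suff E : p = q by rewrite E eqxx in XY.
  case/setU1P: xX xY => [->|/imsetP[a _ ->]]; first by rewrite blk_r => /eqP.
  by case/blk_l=> b /Brain /sI.
case=> P [[/subsetP PBs Pdis] cardP].
(* [g] selects a new point of each block; the default is never reached on a block. Disjointness
   makes [g] injective on [P], whence the bound [rho]. *)
pose g (X : {set 'I_(3 * #|T| + rho)}) :=
  odflt (Ordinal rho_gt0) [pick p | h (inr p) \in X].
have gP X : X \in P -> h (inr (g X)) \in X.
  move=> /PBs /BsP XBs; rewrite /g; case: pickP => //= noX.
  case: XBs => [[p [i EX]]|[A /Ds4 A4 EX]].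
    by have := noX p; rewrite EX blk_r eqxx.
  have /card_gt0P[p pA] : 0 < #|A| by rewrite A4.
  by have := noX p; rewrite EX top_r pA.
suff : #|P| <= #|'I_rho| by rewrite cardP card_ord ltnn.
rewrite -(card_in_imset (f := g)) ?max_card // => X Y XP YP E.
apply/eqP; apply: contraT => XY.
have /pred0P/(_ (h (inr (g X)))) /= := Pdis _ _ XP YP XY.
by rewrite gP // E gP.
Qed.

(** * Adding points at infinity *)

Definition place (G : zmodType) (l : level) (u : G) : G :=
  (match l with None => u | Some false => u *+ 2 | Some true => - u end)%R.

(* The five triples to break: [inl false], [inl true] stand for z, z' and
   [inr k] for t_k. *)
Definition spot : finType := (bool + level)%type.

(** The pure triple on level [k] takes its point [None] from t_k and the two others from z and
    z'. *)
Definition triple_spot (k a : level) : spot := if a is Some b then inl b else inr k.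

(* The triples of a class in the orbit of the base class: [Pure j k] is the one
   on level [k], and [Infinite j k] the one through the point [(k, inr j)] at
   infinity. *)
Variant shape (G S : Type) :=
  | Base of G
  | Pure of S & level
  | Infinite of S & level.

Section Extension.
Variables (G : finZmodType) (S : finType) (tau : S * spot -> G).
Local Open Scope ring_scope.
Hypotheses (no2 : forall x : G, x *+ 2 = 0 -> x = 0).
Hypotheses (no3 : forall x : G, x *+ 3 = 0 -> x = 0).
Hypotheses (tauI : injective tau) (tau0 : forall q, tau q != 0).
Let triple j k a := tau (j, triple_spot k a).
(** Difference condition: on each level, distinct translates of pure triples never share two points.
    Stating it on labels suffices, because [place k] is additive and injective. *)
Hypothesis tauB : forall k a b a' b' j j', a != b -> a' != b' ->
  triple j k a - triple j k b = triple j' k a' - triple j' k b' ->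
  triple j k a = triple j' k a'.
Hypothesis goodS : rainbow_factors S.

Lemma placeB (l : level) (u v : G) : place l (u - v) = place l u - place l v.
Proof. by case: l => [[]|] //=; rewrite ?mulrnBl // opprB opprK addrC. Qed.

Lemma place_eq0 (l : level) (u : G) : place l u = 0 -> u = 0.
Proof.
by case: l => [[]|] //=; [move/eqP; rewrite oppr_eq0 => /eqP | move/no2].
Qed.

Lemma placeI (l : level) : injective (@place G l).
Proof.
move=> u v E; apply/eqP; rewrite -subr_eq0; apply/eqP/(@place_eq0 l).
by rewrite placeB E subrr.
Qed.

(** The multipliers 1, 2, -1 of the levels differ pairwise by 1, 2 or 3 up to sign, and none of
    these kills a nonzero element. *)
Lemma place_levels (l l' : level) (u : G) : l != l' -> place l u = place l' u -> u = 0.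
Proof.
have n3 (w : G) : w *+ 2 + w = 0 -> w = 0 by rewrite -mulrSr => /no3.
have n2 (w : G) : w + w = 0 -> w = 0 by rewrite -mulr2n => /no2.
have n1 (w : G) : w *+ 2 - w = 0 -> w = 0 by rewrite mulr2n addrK.
case: l l' => [[]|] [[]|] //= _ /esym/eqP; rewrite -subr_eq0 ?opprK => /eqP.
- by move/n3.
- by move/n2.
- by move/eqP; rewrite -oppr_eq0 opprB opprK => /eqP/n3.
- by rewrite -opprB => /eqP; rewrite oppr_eq0 => /eqP/n1.
- by move/eqP; rewrite -opprD oppr_eq0 => /eqP/n2.
- by move/n1.
Qed.

(** Both levels send [u - v] to [h - g], so [place_levels] forces [u - v] to be zero. *)
Lemma place_shift_inj (l l' : level) (u v g h : G) : l != l' ->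
  place l u + g = place l v + h -> place l' u + g = place l' v + h ->
  u = v /\ g = h.
Proof.
have shift k : place k u + g = place k v + h -> place k (u - v) = h - g.
  by rewrite placeB => /(canRL (addrK _)) ->; apply/eqP; rewrite subr_eq -addrA addrC.
move=> ll' E /shift E'; have /(place_levels ll') := etrans (shift _ E) (esym E').
by move/eqP; rewrite subr_eq0 => /eqP uv; move: E; rewrite uv => /addrI.
Qed.

(* The five broken triples of index [j] are replaced by six: their labels and
   [inr j] name the new ones. *)
Definition shape_of (i : G + S) : shape G S :=
  match i with
  | inl u => match [pick q | tau q == u] with
             | None => Base S u
             | Some (j, inl false) => Pure G j None
             | Some (j, inl true) => Pure G j (Some false)
             | Some (j, inr k) => Infinite G j k
             end
  | inr j => Pure G j (Some true)
  end.

Definition unshape (s : shape G S) : G + S :=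
  match s with
  | Base u => inl u
  | Pure j None => inl (tau (j, inl false))
  | Pure j (Some false) => inl (tau (j, inl true))
  | Pure j (Some true) => inr j
  | Infinite j k => inl (tau (j, inr k))
  end.

Lemma shape_ofK : cancel shape_of unshape.
Proof.
move=> [u|j] //=; case: pickP => [[j [[]|k]] /eqP <-|] //=.
Qed.

Lemma shape_of_Base i u : shape_of i = Base S u -> forall q, tau q != u.
Proof.
case: i => [v|j] //=; case: pickP => [[j [[]|k]] _|noq [<-] q] //.
by rewrite noq.
Qed.

Definition spread (g : G) (s : shape G S) (a : level) : level * (G + S) :=
  match s with
  | Base u => (a, inl (place a u + g))
  | Pure j k => (k, inl (place k (triple j k a) + g))
  | Infinite j k =>
      if a == k then (k, inr j) else (a, inl (place a (tau (j, inr k)) + g))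
  end.

Lemma triple_inj k j j' a a' : triple j k a = triple j' k a' -> j = j' /\ a = a'.
Proof. by move/tauI=> [-> ]; case: a a' => [[]|] [[]|]. Qed.

Lemma spread_inj g i i' a a' :
  spread g (shape_of i) a = spread g (shape_of i') a' -> i = i' /\ a = a'.
Proof.
(* On level [l] the pure triples use up t_l only; the points of the other t_k on that level stay in
   the triples through infinity. *)
have bad k j l b j' : l != k -> (tau (j, inr k) == triple j' l b) = false.
  move=> lk; apply/negP=> /eqP /tauI []; case: b => //= _ [E].
  by rewrite E eqxx in lk.
pose valid (s : shape G S) := if s is Base u then forall q, tau q != u else True.
have shape_valid x : valid (shape_of x).
  by case E: (shape_of x) => //; apply: shape_of_Base E.
suff H s s' : valid s -> valid s' -> spread g s a = spread g s' a' -> s = s' /\ a = a'.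
  move=> /(H _ _ (shape_valid i) (shape_valid i')) [E ->].
  by split=> //; apply: (can_inj shape_ofK).
case: s s' => [u|j k|j k] [u'|j' k'|j' k'] /= vs vs'.
- by move=> [<- /addIr/placeI ->].
- move=> [<- /addIr/placeI E]; by have := vs (j', triple_spot a a'); rewrite E eqxx.
- case: eqP => [//|_] [<- /addIr/placeI E]; by have := vs (j', inr k'); rewrite E eqxx.
- move=> [<- /addIr/placeI E]; by have := vs' (j, triple_spot k a); rewrite -E eqxx.
- by move=> [<- /addIr/placeI/triple_inj[-> ->]].
- case: eqVneq => [//|ak'] [Ek /addIr]; rewrite Ek => /placeI/esym/eqP.
  by rewrite bad.
- case: eqP => [//|_] [<- /addIr/placeI E]; by have := vs' (j, inr k); rewrite -E eqxx.
- case: eqVneq => [//|ak'] [Ek /addIr]; rewrite Ek => /placeI/eqP.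
  by rewrite bad // -Ek.
case: eqVneq => [->|ak]; case: eqVneq => [->|ak'] //.
  by move=> [-> ->].
by move=> [<- /addIr/placeI/tauI [-> ->]].
Qed.

(* What it means for [p] and [q] to share a triple of the class [c]; a pair
   determines [c] except when both points are at infinity. *)
Definition link (c : G + S) (p q : level * (G + S)) : Prop :=
  match p, q with
  | (_, inr _), (_, inr _) => True
  | (k, inr j), (l, inl x) | (l, inl x), (k, inr j) =>
      exists2 g, c = inl g & x = place l (tau (j, inr k)) + g
  | (l, inl x), (l', inl y) =>
      if l == l' then
        exists g j a b, [/\ a != b, c = inl g,
          x = place l (triple j l a) + g & y = place l (triple j l b) + g]
      else
        exists u g, [/\ x = place l u + g, y = place l' u + g
          & (c = inl g /\ forall j, u <> tau (j, inl false)) \/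
            (exists2 j, c = inr j & u = tau (j, inl false))]
  end.

Lemma link_spread g i a b : a != b ->
  link (inl g) (spread g (shape_of i) a) (spread g (shape_of i) b).
Proof.
move=> ab; case E: (shape_of i) => [u|j k|j k] /=.
- rewrite (negPf ab); exists u, g; split=> //; left; split=> // j E'.
  by have := shape_of_Base E (j, inl false); rewrite E' eqxx.
- by rewrite eqxx; exists g, j, a, b.
case: eqVneq => [Ea|ak]; case: eqVneq => [Eb|bk].
- by rewrite Ea Eb eqxx in ab.
- by exists g.
- by exists g.
rewrite /= (negPf ab); exists (tau (j, inr k)), g; split=> //; left; split=> // j'.
by move/tauI.
Qed.

(** Two points of one level yield the translate by the difference condition. On distinct levels they
    determine label and translate, and the label tells whether it is a freed z, hence an additional
    class. With one point at infinity, the finite point yields the translate. *)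
Lemma link_eq c d p q : (forall k j l j', p = (k, inr j) -> q = (l, inr j') -> c = d) ->
  p != q -> link c p q -> link d p q -> c = d.
Proof.
case: p q => [l [x|j]] [l' [y|j']] /= cd.
- case: (eqVneq l l') => [<- xy|ll' _].
    move=> [g [j [a [b [ab -> Ex Ey]]]]] [h [j' [a' [b' [ab' -> Ex' Ey']]]]].
    suff E : triple j l a = triple j' l a'.
      by have := etrans (esym Ex) Ex'; rewrite E => /addrI ->.
    apply: (tauB ab ab'); apply: (@placeI l); rewrite !placeB.
    have cancel_shift u v w : (u + w) - (v + w) = u - v :> G.
      by rewrite opprD addrACA subrr addr0.
    by rewrite -(cancel_shift _ _ g) -Ex -Ey Ex' Ey' cancel_shift.
  move=> [u [g [Ex Ey H]]] [v [h [Ex' Ey' H']]].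
  have [uv gh] := place_shift_inj ll' (etrans (esym Ex) Ex') (etrans (esym Ey) Ey').
  case: H H' => [[-> nz]|[j -> Ej]] [[-> nz']|[j' -> Ej']].
  + by rewrite gh.
  + by case: (nz j'); rewrite uv.
  + by case: (nz' j); rewrite -uv.
  by move: Ej; rewrite uv Ej' => /tauI [->].
- by move=> _ [g -> ->] [h -> /addrI ->].
- by move=> _ [g -> ->] [h -> /addrI ->].
by move=> _ _ _; apply: (cd l j l' j').
Qed.


Lemma rainbow_factors_extend : rainbow_factors (G + S)%type.
Proof.
have [B [r [BI Blin Brain]]] := goodS.
pose lift (p : level * S) : level * (G + S) := (p.1, inr p.2).
(* The additional class [inr j] consists of all translates of the freed triple z of index [j] and of
   the class [j] at infinity. *)
pose F (c i : G + S) a := match c with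
  | inl g => spread g (shape_of i) a
  | inr j => match i with
             | inl h => (a, inl (place a (tau (j, inl false)) + h))
             | inr i' => lift (B j i' a)
             end
  end.
(* By [tau0] the triple with label 0 is unbroken: its translates cover the finite points, and the
   transversal of the small system stays at infinity. *)
pose R (c : G + S) : G + S := if c is inr j then inr (r j) else inl 0.
have liftI : injective lift by move=> [k j] [k' j'] [-> ->].
have Flink c i a b : a != b -> link c (F c i a) (F c i b).
  move=> ab; case: c i => [g|j] i; first exact: link_spread.
  case: i => [h|i] //=; rewrite (negPf ab).
  by exists (tau (j, inl false)), h; split=> //; right; exists j.
have FI c i i' a a' : F c i a = F c i' a' -> i = i' /\ a = a'.
  case: c => [g|j] /=; first exact: spread_inj.
  case: i i' => [h|i] [h'|i'] //.
    by move=> [<-] /addrI ->.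
  by move/liftI/BI=> [-> ->].
(* A triple of a class [inl g] has at most one point at infinity, so pairs at infinity occur only in
   additional classes. *)
have spread1 g i a b k w l w' : a != b ->
    spread g (shape_of i) a = (k, inr w) -> spread g (shape_of i) b = (l, inr w') -> False.
  case: (shape_of i) => [//|//|j x] ab /=.
  case: eqVneq => // Ea _; case: eqVneq => // Eb _.
  by rewrite Ea Eb eqxx in ab.
exists F, R; split=> //.
- move=> c d i j a b a' b' ab Ea Eb.
  have ab' : a' != b'.
    apply: contraNneq ab => E; move: Eb; rewrite -E -Ea => /FI[_ ->] //.
  apply: (link_eq _ _ (Flink c i a b ab)); last 2 first.
  + by apply: contraNneq ab => /FI[_ ->].
  + by rewrite Ea Eb; apply: Flink.
  move=> k w l w' Ep Eq.
  case: c d Ep Eq Ea Eb => [g|c] [h|d] Ep Eq Ea Eb.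
  + by case: (spread1 g i a b k w l w' ab Ep Eq).
  + by case: (spread1 g i a b k w l w' ab Ep Eq).
  + by case: (spread1 h j a' b' k w l w' ab'); rewrite -?Ep -?Eq.
  congr inr; case: i j Ep Eq Ea Eb => [//|i] [//|j] _ _ /liftI Ea /liftI Eb.
  exact: Blin ab Ea Eb.
have R0 g a : F (inl g) (R (inl g)) a = (a, inl g).
  rewrite /= /shape_of; case: pickP => [q /eqP E|_] /=.
    by have := tau0 q; rewrite E eqxx.
  congr (_, inl _); rewrite (_ : place a 0 = 0) ?add0r //.
  by case: a => [[]|]; rewrite /= ?mul0rn ?oppr0.
move=> [g|j] [h|j'] a b.
- by rewrite !R0 => [] [_ ->].
- by rewrite R0.
- by rewrite R0.
by move=> /liftI /Brain ->.
Qed.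

End Extension.

(** * Starters *)

Definition levels : seq level := [:: None; Some false; Some true].

Lemma levels_all (a : level) : a \in levels.
Proof. by case: a => [[]|]. Qed.

(** This order, z, z', t_0, t_1, t_2, is that of the entries in each row of [Q] below. *)
Definition spots : seq spot := inl false :: inl true :: map inr levels.

Lemma spots_all (x : spot) : x \in spots.
Proof. by case: x => [[]|[[]|]]. Qed.

Lemma inZp_eq p (x y : nat) : (inZp x == inZp y :> 'I_p.+1) = (x == y %[mod p.+1]).
Proof. by []. Qed.

Lemma inZpD p (x y : nat) : (inZp x + inZp y)%R = inZp (x + y) :> 'I_p.+1.
Proof. by apply/val_inj; rewrite /= modnDm. Qed.

(** The bounds say that [x] and [y] differ by less than [m], without truncated subtraction; a
    multiple of [p.+1] that small is zero. *)
Lemma inZp_inj_lt p m (x y : nat) : m <= p.+1 -> x < y + m -> y < x + m ->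
  inZp x = inZp y :> 'I_p.+1 -> x = y.
Proof.
wlog xy : x y / x <= y.
  move=> H mp xy yx E; case: (leqP x y) => [/H|/ltnW/H/(_ mp yx xy (esym E))]; auto.
move=> mp _ yx /esym/eqP; rewrite inZp_eq eqn_mod_dvd // => /dvdn_leq.
lia.
Qed.

Lemma ord_mulrn_eq0 p k (x : 'I_p.+1) : coprime p.+1 k -> (x *+ k = 0)%R -> x = 0%R.
Proof.
move=> co /eqP; rewrite Zp_mulrn -[0%R](valZpK) inZp_eq mod0n -/(dvdn _ _).
rewrite Gauss_dvdl // /dvdn modn_small // => /eqP x0.
exact: val_inj.
Qed.

(** Here [a] is only a position in the triple; the level of the point is coded by the second entry
    of the pair. *)
Definition starter_cell (L : seq (seq (nat * nat))) (i : nat) (a : level) : level * nat :=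
  let q := nth (0, 0) (nth [::] L i) (index a levels) in (nth None levels q.2, q.1).

(* The triples of [L] list points as (element of Z_n, level). The first one
   meets the three levels, so that its translates form the transversal. *)
Definition starter (n : nat) (L : seq (seq (nat * nat))) : bool :=
  all (fun a => all (fun b =>
    ((starter_cell L 0 a).1 == (starter_cell L 0 b).1) ==> (a == b)) levels) levels &&
  all (fun i => all (fun a =>
    let p := starter_cell L i a in
    all (fun j => all (fun b =>
      let q := starter_cell L j b in
      if p.1 == q.1 then
        (if p.2 == q.2 %[mod n] then (i == j) && (a == b) else true) &&
        all (fun a' => all (fun b' =>
          if (a' != a) && (b' != b) then
            let p' := starter_cell L i a' in
            let q' := starter_cell L j b' in
            if (p'.1 == q'.1) && (p'.2 + q.2 == q'.2 + p.2 %[mod n])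
            then (i == j) && (a == b) else true
          else true) levels) levels
      else true) levels) (iota 0 n)) levels) (iota 0 n).

(** The classes are the translates of [L]. A pair common to two classes would give one difference
    between the same levels twice; its two occurrences in [L] therefore coincide, and so do the
    translates. *)
Lemma rainbow_factors_starter p L : starter p.+1 L -> rainbow_factors 'I_p.+1.
Proof.
move=> /andP[L0 LP].
have iotaP (i : 'I_p.+1) : val i \in iota 0 p.+1 by rewrite mem_iota /=.
have {}LP (i : 'I_p.+1) a := allP (allP LP _ (iotaP i)) _ (levels_all a).
pose cell (i : 'I_p.+1) a := starter_cell L i a.
have diffP i j a b a' b' : a' != a -> b' != b ->
    (cell i a).1 = (cell j b).1 -> (cell i a').1 = (cell j b').1 ->
    (cell i a').2 + (cell j b).2 = (cell j b').2 + (cell i a).2 %[mod p.+1] ->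
    i = j /\ a = b.
  move=> na nb E E' Em; have := LP i a.
  move/allP/(_ _ (iotaP j))/allP/(_ _ (levels_all b)).
  rewrite -/(cell i a) -/(cell j b) E eqxx => /andP[_].
  move/allP/(_ _ (levels_all a'))/allP/(_ _ (levels_all b')).
  rewrite na nb -/(cell i a') -/(cell j b') E' Em !eqxx /= => /andP[/eqP ij /eqP ab].
  by split; [apply/ord_inj | ].
have injP i j a b : (cell i a).1 = (cell j b).1 ->
    (cell i a).2 = (cell j b).2 %[mod p.+1] -> i = j /\ a = b.
  move=> E Em; have := LP i a.
  move/allP/(_ _ (iotaP j))/allP/(_ _ (levels_all b)).
  rewrite -/(cell i a) -/(cell j b) E Em !eqxx => /andP[/andP[/eqP ij /eqP ab] _].
  by split; [apply/ord_inj | ].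
have zeroP a b : (cell 0%R a).1 = (cell 0%R b).1 -> a = b.
  move/eqP=> E; apply/eqP.
  exact: implyP (allP (allP L0 _ (levels_all a)) _ (levels_all b)) E.
have pairI (l l' : level) (x y : 'I_p.+1) : (l, x) = (l', y) -> l = l' /\ x = y.
  by move=> E; rewrite (congr1 fst E : l = l') (congr1 snd E : x = y).
pose B (g i : 'I_p.+1) a := ((cell i a).1, (inZp (cell i a).2 + g)%R : 'I_p.+1).
exists B, (fun=> 0%R); split.
- move=> c i i' a a' /pairI[E /addIr X].
  by apply: injP => //; apply/eqP; rewrite -inZp_eq X.
- move=> c d i j a b a' b' ab /pairI[Ea Xa] /pairI[Eb Xb].
  have ab' : a' != b'.
    apply: contraNneq ab => E; rewrite -E in Eb Xb.
    suff [_ ->] : i = i /\ a = b by [].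
    apply: injP; first by rewrite Ea Eb.
    by apply/eqP; rewrite -inZp_eq; apply/eqP/(addIr c); rewrite Xa Xb.
  have [ij aa'] : i = j /\ a = a'.
    apply: (diffP i j a a' b b') => //; rewrite 1?eq_sym //.
    apply/eqP; rewrite -inZp_eq -!inZpD; apply/eqP/(addIr (c + d)%R).
    by rewrite addrACA Xb -Xa addrACA; congr (_ + _)%R; rewrite addrC.
  by move: Xa; rewrite ij aa' => /addrI.
by move=> c d a b /pairI[/zeroP -> /addrI].
Qed.

(** * Choosing the broken triples in a cyclic system *)

Definition removed (Q : seq (seq nat)) (j : nat) (x : spot) : nat :=
  nth 0 (nth [::] Q j) (index x spots).

(* The bounds by [m] make the integer conditions valid modulo every
   [n >= m]. *)
Definition removable (m : nat) (Q : seq (seq nat)) : bool :=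
  let js := iota 0 (size Q) in
  let triple j k a := removed Q j (triple_spot k a) in
  [&& all (fun j => all (fun x => 0 < removed Q j x < m) spots) js,
      all (fun j => all (fun x => all (fun j' => all (fun x' =>
        (removed Q j x == removed Q j' x') ==> (j == j') && (x == x'))
        spots) js) spots) js
    & all (fun k => all (fun j => all (fun a => all (fun b =>
        all (fun j' => all (fun a' => all (fun b' =>
          if (a != b) && (a' != b') then
            let u := triple j k a + triple j' k b' in
            let v := triple j' k a' + triple j k b in
            [&& u < v + m, v < u + m
              & (u == v) ==> (triple j k a == triple j' k a')]
          else true) levels) levels) js) levels) levels) js) levels].

Lemma rainbow_factors_cyclic m p Q : removable m Q -> m <= p.+1 -> coprime p.+1 6 ->
  rainbow_factors 'I_(size Q) -> rainbow_factors ('I_p.+1 + 'I_(size Q))%type.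
Proof.
case/and3P=> Qlt Quniq Qdiff mp; rewrite -[6]/(2 * 3) coprimeMr => /andP[co2 co3] S.
have jP (j : 'I_(size Q)) : val j \in iota 0 (size Q) by rewrite mem_iota /=.
have rlt (j : 'I_(size Q)) x : 0 < removed Q j x < m.
  exact: allP (allP Qlt _ (jP j)) _ (spots_all x).
pose tau (q : 'I_(size Q) * spot) : 'I_p.+1 := inZp (removed Q q.1 q.2).
apply: (@rainbow_factors_extend _ _ tau) => //.
- by move=> x; apply: ord_mulrn_eq0.
- by move=> x; apply: ord_mulrn_eq0.
- move=> [j x] [j' x'] /(inZp_inj_lt mp) /= E.
  have := allP (allP (allP (allP Quniq _ (jP j)) _ (spots_all x)) _ (jP j')) _ (spots_all x').
  have := rlt j x; have := rlt j' x' => /andP[_ lt'] /andP[_ lt].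
  rewrite E ?eqxx; [|exact: ltn_addl|exact: ltn_addl].
  by move=> /andP[/eqP/ord_inj-> /eqP->].
- move=> [j x]; have /andP[gt0 ltm] := rlt j x.
  apply/eqP=> /(congr1 val) /=; rewrite modn_small; last exact: leq_trans ltm mp.
  by move=> E; rewrite E in gt0.
move=> k a b a' b' j j' ab ab' E.
have := allP (allP Qdiff _ (levels_all k)) _ (jP j).
move/allP/(_ _ (levels_all a))/allP/(_ _ (levels_all b))/allP/(_ _ (jP j')).
move/allP/(_ _ (levels_all a'))/allP/(_ _ (levels_all b')).
rewrite ab ab' /= => /and3P[lt1 lt2 /implyP H].
rewrite /tau /=; congr inZp; apply/eqP/H/eqP.
apply: (inZp_inj_lt mp lt1 lt2); rewrite -!inZpD.
(* Equal differences are rewritten as equal sums, the form tested by [removable]. *)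
move/eqP: E; rewrite subr_eq addrAC eq_sym subr_eq => /eqP E.
by rewrite -[LHS]E addrC.
Qed.

(** * Orders *)

Definition order_factorable (n : nat) : Prop :=
  exists2 T : finType, #|T| = n & rainbow_factors T.

Lemma order_factorable_starter n L : 0 < n -> starter n L -> order_factorable n.
Proof.
by case: n => // p _ /rainbow_factors_starter H; exists 'I_p.+1; rewrite ?card_ord.
Qed.

Lemma order_factorable_cyclic m n Q :
  removable m Q -> m + size Q <= n -> 0 < n - size Q ->
  coprime (n - size Q) 6 -> rainbow_factors 'I_(size Q) -> order_factorable n.
Proof.
move=> HQ le gt0 co S; case E: (n - size Q) gt0 co => [//|p] _ co.
exists ('I_p.+1 + 'I_(size Q))%type; first by rewrite card_sum !card_ord; lia.
by apply: (rainbow_factors_cyclic HQ) => //; lia.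
Qed.

(* The levels are permuted cyclically. *)
Definition rotations (L : seq (seq (nat * nat))) : seq (seq (nat * nat)) :=
  [seq [seq (q.1, (q.2 + r) %% 3) | q <- b] | r <- iota 0 3, b <- L].

Definition fixed := [:: (0, 0); (0, 1); (0, 2)].

(* Found by computer search. *)
Lemma order_factorable_small n : n \in [:: 4; 8; 9; 10; 15; 16; 21; 22; 27; 28; 34] ->
  order_factorable n.
Proof.
rewrite !inE.
case/orP=> [/eqP->|].
  by apply: (@order_factorable_starter 4 (fixed :: rotations
      [:: [:: (1,0); (2,0); (3,1)]])); vm_compute.
case/orP=> [/eqP->|].
  (* No cyclic symmetry of the levels is possible here: as 8 is 2 modulo 3, at least two triples
     would be fixed by it, and they would repeat the difference 0. *)
  by apply: (@order_factorable_starter 8 [:: fixed; [:: (1,0); (3,0); (7,1)];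
      [:: (1,1); (2,2); (3,1)]; [:: (1,2); (2,0); (7,0)]; [:: (2,1); (5,2); (7,2)];
      [:: (3,2); (4,2); (6,0)]; [:: (4,0); (5,1); (6,1)]; [:: (4,1); (5,0); (6,2)]]);
      vm_compute.
case/orP=> [/eqP->|].
  by apply: (@order_factorable_starter 9 (rotations [:: [:: (4,0); (6,1); (7,2)];
      [:: (0,0); (1,0); (5,1)]; [:: (3,0); (8,0); (2,1)]])); vm_compute.
case/orP=> [/eqP->|].
  by apply: (@order_factorable_starter 10 (fixed :: rotations
      [:: [:: (1,0); (2,1); (6,2)]; [:: (3,0); (4,0); (7,2)]; [:: (5,0); (9,0); (8,1)]]));
      vm_compute.
case/orP=> [/eqP->|].
  by apply: (@order_factorable_starter 15 (rotations [:: [:: (0,0); (1,1); (10,2)];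
      [:: (2,0); (6,0); (7,2)]; [:: (3,0); (12,0); (5,2)]; [:: (4,0); (14,0); (8,2)];
      [:: (9,0); (11,0); (13,1)]])); vm_compute.
case/orP=> [/eqP->|].
  by apply: (@order_factorable_starter 16 (fixed :: rotations
      [:: [:: (1,0); (2,1); (11,2)]; [:: (3,0); (8,1); (7,2)]; [:: (4,0); (6,1); (9,2)];
      [:: (5,0); (12,0); (14,2)]; [:: (10,0); (13,0); (15,0)]])); vm_compute.
case/orP=> [/eqP->|].
  by apply: (@order_factorable_starter 21 (rotations [:: [:: (0,0); (13,1); (19,2)];
      [:: (1,0); (5,0); (7,2)]; [:: (2,0); (3,1); (20,2)]; [:: (4,0); (18,1); (17,2)];
      [:: (6,0); (12,0); (15,2)]; [:: (8,0); (11,0); (16,0)];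
      [:: (9,0); (10,0); (14,1)]])); vm_compute.
case/orP=> [/eqP->|].
  by apply: (@order_factorable_starter 22 (fixed :: rotations
      [:: [:: (1,0); (14,1); (20,2)]; [:: (2,0); (6,1); (8,2)]; [:: (3,0); (21,1); (4,2)];
      [:: (12,0); (18,0); (5,1)]; [:: (7,0); (16,0); (17,1)]; [:: (9,0); (11,0); (19,2)];
      [:: (10,0); (13,0); (15,2)]])); vm_compute.
case/orP=> [/eqP->|].
  by apply: (@order_factorable_starter 27 (rotations [:: [:: (0,0); (7,1); (16,2)];
      [:: (1,0); (15,1); (6,2)]; [:: (2,0); (10,1); (9,2)]; [:: (3,0); (24,1); (25,2)];
      [:: (4,0); (13,0); (18,0)]; [:: (20,0); (21,0); (5,2)]; [:: (8,0); (12,1); (22,2)];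
      [:: (11,0); (17,0); (14,1)]; [:: (19,0); (23,0); (26,0)]])); vm_compute.
case/orP=> [/eqP->|].
  by apply: (@order_factorable_starter 28 (fixed :: rotations
      [:: [:: (1,0); (8,1); (17,2)]; [:: (2,0); (16,1); (7,2)];
      [:: (3,0); (11,1); (10,2)]; [:: (4,0); (25,0); (26,1)]; [:: (5,0); (24,0); (22,1)];
      [:: (6,0); (14,0); (18,2)]; [:: (9,0); (13,1); (19,2)]; [:: (23,0); (27,0); (12,2)];
      [:: (15,0); (20,0); (21,0)]])); vm_compute.
move/eqP->.
by apply: (@order_factorable_starter 34 (fixed :: rotations
      [:: [:: (1,0); (14,1); (24,2)]; [:: (2,0); (7,1); (29,2)];
      [:: (3,0); (11,1); (17,2)]; [:: (4,0); (22,1); (15,2)]; [:: (5,0); (10,0); (13,2)];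
      [:: (6,0); (31,1); (16,2)]; [:: (8,0); (26,0); (32,0)]; [:: (12,0); (23,0); (9,2)];
      [:: (18,0); (25,0); (19,1)]; [:: (20,0); (33,0); (21,2)];
      [:: (27,0); (28,0); (30,0)]])); vm_compute.
Qed.

Lemma order_factorable_all n : 4 <= n -> n != 6 -> order_factorable n.
Proof.
move=> n4 n6.
case: (boolP (n \in [:: 4; 8; 9; 10; 15; 16; 21; 22; 27; 28; 34])) => [|nsmall].
  exact: order_factorable_small.
have co m k : k \in [:: 1; 5] -> m = k %[mod 6] -> coprime m 6.
  move=> k15 E; rewrite -coprime_modl E coprime_modl.
  by move: k15; rewrite !inE => /orP[]/eqP->.
rewrite !inE in nsmall.
(* These cases take s = 0, 1, 4, 5 respectively, so that [n - s] is 1 or 5 modulo 6. *)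
have [] : n %% 6 \in [:: 1; 5] \/ n %% 6 \in [:: 0; 2] \/ n %% 6 = 3 \/ n %% 6 = 4.
  by rewrite !inE; lia.
- move=> H; apply: (@order_factorable_cyclic 1 n [::]); rewrite ?subn0 //=; first lia.
  + lia.
  + by apply: co H _; rewrite modn_mod.
  by exists (fun _ i _ => (None, i)), id; split; case.
case=> [H|[H|H]].
(* Here and below, the bound [m] is one more than twice the largest difference within a pure triple:
   2 * 5 + 1, 2 * 14 + 1, 2 * 17 + 1. *)
- apply: (@order_factorable_cyclic 11 n [:: [:: 2; 5; 1; 7; 4]]) => //=.
  + by move: H; rewrite !inE; lia.
  + lia.
  + apply: (@co _ ((n - 1) %% 6)); last by rewrite modn_mod.
    by move: H; rewrite !inE; lia.
  by apply: (@rainbow_factors_starter 0 [:: fixed]); vm_compute.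
- apply: (@order_factorable_cyclic 29 n [:: [:: 16; 21; 10; 19; 25];
    [:: 7; 17; 14; 3; 5]; [:: 2; 15; 1; 9; 8]; [:: 12; 20; 24; 11; 23]]) => //=; try lia.
  + by apply: (co _ 5) => //; lia.
  apply: (@rainbow_factors_starter 3
    (fixed :: rotations [:: [:: (1, 0); (2, 0); (3, 1)]])).
  by vm_compute.
apply: (@order_factorable_cyclic 35 n [:: [:: 11; 28; 12; 18; 19];
  [:: 13; 1; 5; 4; 8]; [:: 31; 33; 26; 17; 34]; [:: 21; 10; 24; 25; 6];
  [:: 14; 20; 29; 15; 30]]) => //=; try lia.
- by apply: (co _ 5) => //; lia.
(* These are the triples with points u, 2u, -u over Z_5, since 5 is itself coprime to 6. *)
apply: (@rainbow_factors_starter 4 [:: fixed; [:: (1, 0); (2, 1); (4, 2)];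
  [:: (2, 0); (4, 1); (3, 2)]; [:: (3, 0); (1, 1); (2, 2)]; [:: (4, 0); (3, 1); (1, 2)]]).
by vm_compute.
Qed.

Theorem theorem2p6 (n rho : nat) :
  4 <= n -> n != 6 -> 1 <= rho <= n ->
  exists Bs : {set {set 'I_(3 * n + rho)}},
    is_packing 4 Bs /\ #|Bs| = n * rho + Dpack rho 4 /\ largest_PPC_size Bs rho.
Proof.
move=> n4 n6 rho_n; have [T cardT facT] := order_factorable_all n4 n6.
by rewrite -cardT in rho_n *; apply: packing_of_factors.
Qed.
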